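(* Let $k\ge1$, let $\varepsilon_1,\dots,\varepsilon_k>0$ and $\varepsilon_g\in\mathbb{R}$. Let $\mathcal{M}_{\mathrm{BR}}^{1:k}$ be the class of nonadaptive compositions $M_1\times\cdots\times M_k$ in which each $M_i$ is $\varepsilon_i$-bounded-range. For $\varepsilon>0$, $t\in[0,\varepsilon]$ let $q_{\varepsilon,t}=\frac{1-e^{t-\varepsilon}}{1-e^{-\varepsilon}}$ and $p_{\varepsilon,t}=\frac{e^{-t}-e^{-\varepsilon}}{1-e^{-\varepsilon}}$. Then $$\delta_{\mathrm{opt}}(\mathcal{M}_{\mathrm{BR}}^{1:k},\varepsilon_g)=\sup_{(t_1,\dots,t_k)\in\prod_{i=1}^k[0,\varepsilon_i]}\ \sum_{S\subseteq\{1,\dots,k\}}\max\left\{\prod_{i\notin S}q_{\varepsilon_i,t_i}\prod_{i\in S}(1-q_{\varepsilon_i,t_i})-e^{\varepsilon_g}\prod_{i\notin S}p_{\varepsilon_i,t_i}\prod_{i\in S}(1-p_{\varepsilon_i,t_i}),\ 0\right\}.$$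
   Context: A data universe is a set $\mathcal{X}$ with a symmetric neighboring relation $x\sim x'$. A mechanism $M:\mathcal{X}\to\mathcal{Y}$ assigns to each $x$ a probability distribution of a random outcome $M(x)\in\mathcal{Y}$; $\Pr[M(x)=y]$ denotes the probability mass function, or, for continuous outcome spaces, the probability density function with respect to a common reference measure. $M$ is $\varepsilon$-bounded-range ($\varepsilon$-BR) if for all neighbors $x\sim x'$ and all $y_1,y_2\in\mathcal{Y}$, $\frac{\Pr[M(x)=y_1]}{\Pr[M(x')=y_1]}\le e^{\varepsilon}\frac{\Pr[M(x)=y_2]}{\Pr[M(x')=y_2]}$ (in cross-multiplied form when probabilities vanish). $M$ is $(\varepsilon,\delta)$-DP if $\Pr[M(x)\in S]\le e^{\varepsilon}\Pr[M(x')\in S]+\delta$ for all $x\sim x'$ and all (measurable) $S\subseteq\mathcal{Y}$. For $\varepsilon_g\in\mathbb{R}$, $\delta_{\mathrm{opt}}(M,\varepsilon_g)=\inf\{\delta: M\text{ is }(\varepsilon_g,\delta)\text{-DP}\}$, and for a class $\mathcal{M}$, $\delta_{\mathrm{opt}}(\mathcal{M},\varepsilon_g)=\sup_{M\in\mathcal{M}}\delta_{\mathrm{opt}}(M,\varepsilon_g)$. $\mathcal{M}_{\mathrm{BR}}^{1:k}=\{M_1\times\cdots\times M_k: M_i\text{ is }\varepsilon_i\text{-BR}\}$, where $M_1\times\cdots\times M_k$ maps $x$ to $(M_1(x),\dots,M_k(x))$ with independent draws; data universe (with at least one neighboring pair) and outcome spaces are arbitrary. *)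

(* Defs.v *)
From HB Require Import structures.
From mathcomp Require Import all_boot all_order all_algebra.
From mathcomp Require Import all_classical all_reals all_analysis.

Set Implicit Arguments.
Unset Strict Implicit.
Unset Printing Implicit Defensive.

Import Order.TTheory GRing.Theory Num.Theory.
Import numFieldNormedType.Exports.

Local Open Scope classical_set_scope.
Local Open Scope ring_scope.

(* The outcome space is a component of the mechanism, so that a class of
   mechanisms may range over all outcome spaces. *)
Record mechanism (R : realType) (X : Type) := Mechanism {
  mech_disp : measure_display;
  mech_out : measurableType mech_disp;
  mech_law :> X -> probability mech_out R }.

(* [f x] is a density of [M x] with respect to [mu]; the reference measure [mu]
   does not depend on [x].  It need not be sigma-finite: with the counting
   measure, [f x] is a probability mass function on an arbitrary set. *)
Definition is_density (R : realType) (X : Type) (M : mechanism R X)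
    (mu : {measure set (mech_out M) -> \bar R})
    (f : X -> mech_out M -> R) : Prop :=
  [/\ forall x y, 0 <= f x y,
      forall x, measurable_fun setT (f x) &
      forall x (A : set (mech_out M)), measurable A ->
        M x A = (\int[mu]_(y in A) (f x y)%:E)%E].

Definition bounded_range (R : realType) (X : Type) (nb : X -> X -> Prop)
    (eps : R) (M : mechanism R X) : Prop :=
  exists (mu : {measure set (mech_out M) -> \bar R})
         (f : X -> mech_out M -> R),
    is_density mu f /\
    forall x x', nb x x' -> forall y1 y2 : mech_out M,
      f x y1 * f x' y2 <= expR eps * (f x y2 * f x' y1).

Definition dp (R : realType) (X : Type) (nb : X -> X -> Prop)
    (eps delta : R) (M : mechanism R X) : Prop :=
  forall x x', nb x x' -> forall S : set (mech_out M), measurable S ->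
    (M x S <= (expR eps)%:E * M x' S + delta%:E)%E.

Definition delta_opt (R : realType) (X : Type) (nb : X -> X -> Prop)
    (M : mechanism R X) (eg : R) : \bar R :=
  ereal_inf [set delta%:E | delta in [set delta : R | dp nb eg delta M]].

(* Classes of mechanisms are [Prop]-valued predicates: [mechanism R X] lives in
   too large a universe to be the carrier of a [set]. *)
Definition delta_opt_class (R : realType) (X : Type) (nb : X -> X -> Prop)
    (C : mechanism R X -> Prop) (eg : R) : \bar R :=
  ereal_sup [set d | exists2 M : mechanism R X, C M & delta_opt nb M eg = d].

Definition mech_unit (R : realType) (X : Type) : mechanism R X :=
  Mechanism (fun _ : X => (dirac tt : probability unit R)).

Definition mech_prod (R : realType) (X : Type) (M N : mechanism R X) :
    mechanism R X :=
  Mechanism (fun x : X => ((M x \x N x)%E :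
    probability (mech_out M * mech_out N)%type R)).

(* Tuples of outcomes are right-nested pairs ending in the one-point space:
   x is mapped to (M_0(x), (M_1(x), ( ... , (M_(k-1)(x), tt)))). *)
Definition mech_comp (R : realType) (X : Type) (k : nat)
    (M : 'I_k -> mechanism R X) : mechanism R X :=
  \big[@mech_prod R X / @mech_unit R X]_(i < k) M i.

Definition BR_compositions (R : realType) (X : Type) (nb : X -> X -> Prop)
    (k : nat) (eps : 'I_k -> R) (M : mechanism R X) : Prop :=
  exists2 Mi : 'I_k -> mechanism R X,
    forall i, bounded_range nb (eps i) (Mi i) & M = mech_comp Mi.

Definition q_br (R : realType) (eps t : R) : R :=
  (1 - expR (t - eps)) / (1 - expR (- eps)).

Definition p_br (R : realType) (eps t : R) : R :=
  (expR (- t) - expR (- eps)) / (1 - expR (- eps)).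

(* Main.v *)
Require Import Defs.
From HB Require Import structures.
From mathcomp Require Import all_boot all_order all_algebra.
From mathcomp Require Import all_classical all_reals all_analysis.
From mathcomp Require Import measurable_realfun ring lra.

Set Implicit Arguments.
Unset Strict Implicit.
Unset Printing Implicit Defensive.

Import Order.TTheory GRing.Theory Num.Theory.
Import numFieldNormedType.Exports.

Local Open Scope classical_set_scope.
Local Open Scope ring_scope.

(* For neighbors x, x', the bounded-range condition says that the likelihood
   ratio of M(x) to M(x') takes its values in an interval [e^(t-eps), e^t] with
   0 <= t <= eps.  Replacing the ratio by a random variable of the same mean
   supported on the two endpoints can only increase a convex functional such as
   the hockey-stick divergence, and the resulting pair of laws is
   (Bernoulli(q), Bernoulli(p)); doing this one coordinate at a time bounds the
   composition.  Conversely, the mechanism answering Bernoulli(q) at one point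
   and Bernoulli(p) at all others is eps-bounded-range, and the product of such
   mechanisms attains the sum. *)

(** * Hockey-stick sums over subsets and their recursion on [k] *)

Definition lift0_set k (S : {set 'I_k}) : {set 'I_k.+1} :=
  [set lift ord0 i | i in S]%SET.

Lemma ord0_lift0_set k (S : {set 'I_k}) : (ord0 \in lift0_set S) = false.
Proof. by apply/negbTE/negP => /imsetP[i _ /eqP]; rewrite eq_sym. Qed.

Lemma mem_lift0_set k (S : {set 'I_k}) i :
  (lift ord0 i \in lift0_set S) = (i \in S).
Proof. by rewrite mem_imset//; exact: lift_inj. Qed.

Lemma mem_setU1_lift0_set k (S : {set 'I_k}) i :
  (lift ord0 i \in (ord0 |: lift0_set S)%SET) = (i \in S).
Proof.
by rewrite in_setU1 mem_lift0_set eq_sym (negbTE (neq_lift _ _)).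
Qed.

Section hockey_stick.
Context {R : realType}.

(** For [q] with values in [0, 1], the probability that independent Bernoulli([q i]) bits are false
    exactly on [S]. *)
Definition subset_weight k (q : 'I_k -> R) (S : {set 'I_k}) : R :=
  (\prod_(i | i \notin S) q i) * \prod_(i in S) (1 - q i).

(** Both weights [a] and [c] are kept free because the recursion on [k] changes them; the theorem is
    the case [a = 1], [c = expR eg]. *)
Definition hockey_stick k (q p : 'I_k -> R) (a c : R) : R :=
  \sum_(S : {set 'I_k})
    Num.max (a * subset_weight q S - c * subset_weight p S) 0.

Lemma hockey_stick0 (q p : 'I_0 -> R) a c :
  hockey_stick q p a c = Num.max (a - c) 0.
Proof.
rewrite /hockey_stick (bigD1 finset.set0)//= big1 ?addr0; last first.
  by move=> S /negP[]; apply/eqP/setP => -[].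
by rewrite /subset_weight !big_ord0 !mulr1.
Qed.

Lemma hockey_stickZ k (q p : 'I_k -> R) s a c : 0 <= s ->
  hockey_stick q p (s * a) (s * c) = s * hockey_stick q p a c.
Proof.
move=> s0; rewrite /hockey_stick mulr_sumr; apply: eq_bigr => S _.
by rewrite maxr_pMr// mulr0 mulrBr !mulrA.
Qed.

(** Splits the subsets by membership of [ord0]; [unshift] in the proof recovers the trace on the
    other indices. *)
Lemma sum_setS k (F : {set 'I_k.+1} -> R) :
  \sum_(S : {set 'I_k.+1}) F S =
  \sum_(S : {set 'I_k}) F (lift0_set S) +
  \sum_(S : {set 'I_k}) F (ord0 |: lift0_set S)%SET.
Proof.
pose unshift (S : {set 'I_k.+1}) : {set 'I_k} :=
  [set i | lift ord0 i \in S]%SET.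
have shiftK : cancel (@lift0_set k) unshift.
  by move=> S; apply/setP => i; rewrite inE mem_lift0_set.
have unshift0 (S : {set 'I_k.+1}) : ord0 \notin S -> lift0_set (unshift S) = S.
  move=> S0; apply/setP => i; case: (unliftP ord0 i) => [j ->|->].
    by rewrite mem_lift0_set inE.
  by rewrite ord0_lift0_set (negbTE S0).
rewrite (bigID (fun S : {set 'I_k.+1} => ord0 \notin S))/=; congr (_ + _).
  rewrite (reindex_onto (@lift0_set k) unshift)/=; last by move=> S /unshift0.
  by apply: eq_bigl => S; rewrite ord0_lift0_set shiftK eqxx.
rewrite (reindex_onto (fun S => (ord0 |: lift0_set S)%SET) unshift)/=;
  last first.
  move=> S; rewrite negbK => S0; apply/setP => i.
  case: (unliftP ord0 i) => [j ->|->].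
    by rewrite mem_setU1_lift0_set inE.
  by rewrite setU11 S0.
apply: eq_bigl => S; rewrite setU11/=; apply/eqP/setP => i.
by rewrite inE mem_setU1_lift0_set.
Qed.

Lemma subset_weight_lift0_set k (q : 'I_k.+1 -> R) (S : {set 'I_k}) :
  subset_weight q (lift0_set S) = q ord0 * subset_weight (q \o lift ord0) S.
Proof.
rewrite /subset_weight big_mkcond [X in _ * X]big_mkcond/= !big_ord_recl.
rewrite ord0_lift0_set/= mul1r -mulrA; congr (_ * (_ * _)).
  by rewrite [RHS]big_mkcond; apply: eq_bigr => i _; rewrite mem_lift0_set.
by rewrite [RHS]big_mkcond; apply: eq_bigr => i _; rewrite mem_lift0_set.
Qed.

Lemma subset_weight_setU1_lift0_set k (q : 'I_k.+1 -> R) (S : {set 'I_k}) :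
  subset_weight q (ord0 |: lift0_set S)%SET =
  (1 - q ord0) * subset_weight (q \o lift ord0) S.
Proof.
rewrite /subset_weight big_mkcond [X in _ * X]big_mkcond/= !big_ord_recl.
rewrite setU11/= mul1r mulrCA; congr (_ * (_ * _)).
  rewrite [RHS]big_mkcond; apply: eq_bigr => i _.
  by rewrite mem_setU1_lift0_set.
rewrite [RHS]big_mkcond; apply: eq_bigr => i _.
by rewrite mem_setU1_lift0_set.
Qed.

(** Conditioning on the first bit: the probabilities of its two values are absorbed into the
    weights. *)
Lemma hockey_stick_recl k (q p : 'I_k.+1 -> R) a c :
  hockey_stick q p a c =
  hockey_stick (q \o lift ord0) (p \o lift ord0) (a * q ord0) (c * p ord0) +
  hockey_stick (q \o lift ord0) (p \o lift ord0)
    (a * (1 - q ord0)) (c * (1 - p ord0)).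
Proof.
rewrite /hockey_stick sum_setS; congr (_ + _); apply: eq_bigr => S _.
  by rewrite !subset_weight_lift0_set !mulrA.
by rewrite !subset_weight_setU1_lift0_set !mulrA.
Qed.

End hockey_stick.

(** * The Bernoulli pair with extremal likelihood ratios *)

Section binary_parameters.
Context {R : realType}.
Implicit Types eps t : R.

Lemma p_br_itv eps t : 0 < eps -> 0 <= t <= eps -> 0 <= p_br eps t <= 1.
Proof.
move=> e0 /andP[t0 te]; have e1 : 0 < 1 - expR (- eps).
  by rewrite subr_gt0 -expR0 ltr_expR oppr_lt0.
rewrite /p_br divr_ge0/=; last exact: ltW.
  by rewrite ler_pdivrMr// mul1r lerD2r -[leRHS]expR0 ler_expR oppr_le0.
by rewrite subr_ge0 ler_expR lerN2.
Qed.

(** Together with [onem_q_brE]: the likelihood ratio of Bernoulli(q) to Bernoulli(p) is e^t at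
    [true] and e^(t - eps) at [false], the two ends of the allowed interval. *)
Lemma q_brE eps t : q_br eps t = expR t * p_br eps t.
Proof. by rewrite /q_br /p_br mulrA mulrBr -!expRD subrr expR0. Qed.

Lemma onem_q_brE eps t : 0 < eps ->
  1 - q_br eps t = expR (t - eps) * (1 - p_br eps t).
Proof.
move=> e0; have e1 : 1 - expR (- eps) != 0.
  by rewrite gt_eqF// subr_gt0 -expR0 ltr_expR oppr_lt0.
have -> : 1 - q_br eps t = (expR (t - eps) - expR (- eps)) / (1 - expR (- eps)).
  by rewrite /q_br -[X in X - _](divff e1) -mulrBl; congr (_ / _); ring.
have -> : 1 - p_br eps t = (1 - expR (- t)) / (1 - expR (- eps)).
  by rewrite /p_br -[X in X - _](divff e1) -mulrBl; congr (_ / _); ring.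
by rewrite mulrA mulrBr mulr1 -!expRD addrAC subrr add0r.
Qed.

Lemma q_br_itv eps t : 0 < eps -> 0 <= t <= eps -> 0 <= q_br eps t <= 1.
Proof.
move=> e0 te; have /andP[p0 p1] := p_br_itv e0 te.
rewrite q_brE mulr_ge0 ?expR_ge0//= -q_brE -subr_ge0 onem_q_brE//.
by rewrite mulr_ge0 ?expR_ge0 ?subr_ge0.
Qed.

End binary_parameters.

(** * Likelihood-ratio intervals and the replacement of one coordinate *)

Section likelihood_ratio.
Context {R : realType}.

Lemma fine_probability d (T : measurableType d) (P : probability T R) A :
  measurable A -> (fine (P A))%:E = P A.
Proof. by move=> mA; rewrite fineK// fin_num_measure. Qed.

(* The bound is stated on laws rather than densities: the reference measure need
   not be sigma-finite, and products of laws never refer to it. *)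
Lemma bounded_range_likelihood_ratio (X : Type) (nb : X -> X -> Prop) eps
    (M : mechanism R X) x x' : bounded_range nb eps M -> nb x x' ->
  exists t, 0 <= t <= eps /\ forall A, measurable A ->
    ((expR (t - eps))%:E * M x' A <= M x A)%E /\
    (M x A <= (expR t)%:E * M x' A)%E.
Proof.
case=> mu [f [[f0 mf Mf] br]] xx'.
have int1 z : (\int[mu]_y (f z y)%:E = 1)%E.
  by rewrite -Mf// probability_setT.
have pos z : exists y, 0 < f z y.
  apply/not_existsP => fz; have := int1 z; rewrite integral0_eq => [/eqP|y _].
    by rewrite eq_sym onee_eq0.
  congr _%:E; apply/eqP; rewrite eq_le f0 leNgt.
  by apply/andP; split=> //; apply/negP.
(* The supremum [b] of these ratios will be e^t. *)
pose r := [set f x y / f x' y | y in [set y | 0 < f x' y]].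
have [y0 fy0] := pos x'.
have r0 : r !=set0 by exists (f x y0 / f x' y0); exists y0.
have rle y1 y2 : 0 < f x' y1 -> 0 < f x' y2 ->
    f x y1 / f x' y1 <= expR eps * (f x y2 / f x' y2).
  move=> h1 h2; have := br _ _ xx' y1 y2.
  rewrite ler_pdivrMr//; have -> : expR eps * (f x y2 / f x' y2) * f x' y1 =
    expR eps * (f x y2 * f x' y1) / f x' y2 by ring.
  by rewrite ler_pdivlMr.
have rub : has_ubound r.
  exists (expR eps * (f x y0 / f x' y0)) => _ [y /= fy <-]; exact: rle.
pose b := sup r.
(* Comparing [y] with [y0], where [f x'] is positive, shows that [f x] vanishes wherever [f x']
   does, so the bounds by [b] extend to those points. *)
have fx0 y : f x' y = 0 -> f x y = 0.
  move=> fy; have := br _ _ xx' y y0; rewrite fy !mulr0.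
  by rewrite pmulr_lle0// => h; apply/eqP; rewrite eq_le f0 h.
have fx'0 y : f x' y = 0 \/ 0 < f x' y.
  by have := f0 x' y; rewrite le_eqVlt => /orP[/eqP ->|]; [left|right].
have ub y : f x y <= b * f x' y.
  have [fy|fy] := fx'0 y.
    by rewrite fy mulr0 fx0.
  by rewrite -ler_pdivrMr//; apply: ub_le_sup => //; exists y.
have lb y : b * f x' y <= expR eps * f x y.
  have [fy|fy] := fx'0 y.
    by rewrite fy mulr0 fx0// mulr0.
  rewrite -ler_pdivlMr// -mulrA; apply: ge_sup => // _ [z /= fz <-].
  exact: rle.
have b0 : 0 <= b.
  apply: (@le_trans _ _ (f x y0 / f x' y0)); first by apply: divr_ge0.
  by apply: ub_le_sup => //; exists y0.
have intZ c z A : 0 <= c -> measurable A ->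
    (\int[mu]_(y in A) (c * f z y)%:E = c%:E * M z A)%E.
  move=> c0 mA; rewrite Mf// -ge0_integralZl_EFin//.
  - by move=> y _; rewrite lee_fin.
  - exact/measurable_EFinP/measurable_funTS.
have mfA c z (A : set (mech_out M)) : measurable A ->
    measurable_fun A (fun y => (c * f z y)%:E).
  move=> mA; apply/measurable_EFinP/measurable_funTS.
  exact: measurable_funM.
have ubA A : measurable A -> (M x A <= b%:E * M x' A)%E.
  move=> mA; rewrite -intZ// -[leLHS]mul1e -intZ//.
  apply: ge0_le_integral => //.
  - by move=> y _; rewrite lee_fin mul1r.
  - exact: mfA.
  - exact: mfA.
  - by move=> y _; rewrite lee_fin mul1r.
have lbA A : measurable A -> (b%:E * M x' A <= (expR eps)%:E * M x A)%E.
  move=> mA; rewrite -!intZ ?expR_ge0//; apply: ge0_le_integral => //.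
  - by move=> y _; rewrite lee_fin mulr_ge0.
  - exact: mfA.
  - exact: mfA.
  - by move=> y _; rewrite lee_fin.
(* Both laws have total mass 1, so integrating the pointwise bounds over the whole space gives 1 <=
   b <= e^eps, that is, [ln b] lies in [0, eps]. *)
have b1 : 1 <= b by have := ubA _ measurableT; rewrite !probability_setT mule1.
have be : b <= expR eps.
  by have := lbA _ measurableT; rewrite !probability_setT !mule1 lee_fin.
have bp : 0 < b by exact: lt_le_trans b1.
exists (ln b); split; first by rewrite ln_ge0//= -ler_expR lnK.
move=> A mA; rewrite expRD lnK//; split; last exact: ubA.
have := lbA _ mA; rewrite -(fine_probability (M x) mA).
rewrite -(fine_probability (M x') mA) -!EFinM !lee_fin expRN => h.
by rewrite mulrAC ler_pdivrMr ?expR_gt0// [leRHS]mulrC.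
Qed.

(** The inductive step of the upper bound: [H] stands for the bound on the remaining coordinates,
    and the right-hand side has the shape of [hockey_stick_recl]. *)
Lemma product_hockey_stick_le d1 d2 (T1 : measurableType d1)
    (T2 : measurableType d2) (P1 Q1 : probability T1 R)
    (P2 Q2 : probability T2 R) (eps t : R) (H : R -> R -> R) :
  0 < eps -> 0 <= t <= eps ->
  (forall A, measurable A ->
    ((expR (t - eps))%:E * Q1 A <= P1 A)%E /\
    (P1 A <= (expR t)%:E * Q1 A)%E) ->
  (forall s a c, 0 <= s -> H (s * a) (s * c) = s * H a c) ->
  (forall a c, 0 <= a -> 0 <= c -> forall A, measurable A ->
    a * fine (P2 A) - c * fine (Q2 A) <= H a c) ->
  forall a c, 0 <= a -> 0 <= c -> forall A, measurable A ->
  a * fine ((P1 \x P2)%E A) - c * fine ((Q1 \x Q2)%E A) <=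
  H (a * q_br eps t) (c * p_br eps t) +
  H (a * (1 - q_br eps t)) (c * (1 - p_br eps t)).
Proof.
move=> eps0 te PQ HZ PQ2 a c a0 c0 A mA.
have /andP[p0 p1] := p_br_itv eps0 te.
rewrite onem_q_brE// q_brE; set p := p_br eps t in p0 p1 *.
set u := expR t in PQ *; set l := expR (t - eps) in PQ *.
have u0 : 0 <= u by exact: expR_ge0.
have l0 : 0 <= l by exact: expR_ge0.
(* Homogeneity of [H] extracts [p] and [1 - p], leaving a mixture of [H (a * u) c] and
   [H (a * l) c]. *)
have -> : a * (u * p) = p * (a * u) by ring.
have -> : a * (l * (1 - p)) = (1 - p) * (a * l) by ring.
rewrite [c * p]mulrC [c * (1 - p)]mulrC !HZ ?subr_ge0//.
(* By Fubini, the mass of [A] is the integral over the first outcome of the mass of its section. *)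
pose h y := fine (P2 (xsection A y)); pose g y := fine (Q2 (xsection A y)).
have mx y : measurable (xsection A y) by exact: measurable_xsection.
have mh : measurable_fun setT h.
  apply: measurableT_comp => //; exact: (measurable_fun_xsection P2).
have mg : measurable_fun setT g.
  apply: measurableT_comp => //; exact: (measurable_fun_xsection Q2).
have bnd (S : probability T1 R) (f : T1 -> R) K : measurable_fun setT f ->
    (forall y, `|f y| <= K) -> S.-integrable setT (EFin \o f).
  move=> mf fK; apply: measurable_bounded_integrable => //=.
    exact: le_lt_trans (probability_le1 S measurableT) (ltry _).
  exists K; split; first exact: num_real.
  by move=> M KM y _ /=; rewrite (le_trans (fK y))// ltW.
have h01 y : 0 <= h y <= 1.
  by rewrite -!lee_fin fine_probability// measure_ge0 probability_le1.
have g01 y : 0 <= g y <= 1.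
  by rewrite -!lee_fin fine_probability// measure_ge0 probability_le1.
have bh w y : `|w * h y| <= `|w|.
  by have /andP[? ?] := h01 y; rewrite normrM ler_piMr// ger0_norm.
have bg w y : `|w * g y| <= `|w|.
  by have /andP[? ?] := g01 y; rewrite normrM ler_piMr// ger0_norm.
(* Every function to be integrated below is an affine combination of [h] and [g], so its integral
   reduces to those of [h] and [g]. *)
pose F v w z y := v + w * h y + z * g y.
have mwh w : measurable_fun setT (fun y => w * h y).
  exact: measurable_funM.
have mwg w : measurable_fun setT (fun y => w * g y).
  exact: measurable_funM.
have mF v w z : measurable_fun setT (F v w z).
  by apply: measurable_funD => //; apply: measurable_funD.
have iF (S : probability T1 R) v w z : S.-integrable setT (EFin \o F v w z).
  apply: (bnd _ _ (`|v| + `|w| + `|z|)) => // y.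
  apply: le_trans (ler_normD _ _) _; rewrite lerD//.
  by apply: le_trans (ler_normD _ _) _; rewrite lerD.
pose I (S : probability T1 R) (f : T1 -> R) := (\int[S]_y f y)%R.
have IE (S : probability T1 R) (v w z : R) :
    I S (F v w z) = v + w * I S h + z * I S g.
  have ih : S.-integrable setT (EFin \o h).
    by apply: (bnd _ _ 1) => // y; have /andP[? ?] := h01 y; rewrite ger0_norm.
  have ig : S.-integrable setT (EFin \o g).
    by apply: (bnd _ _ 1) => // y; have /andP[? ?] := g01 y; rewrite ger0_norm.
  rewrite /I /F RintegralD//; last 2 first.
  - apply: (bnd _ _ (`|v| + `|w|)) => [|y]; first exact: measurable_funD.
    by apply: le_trans (ler_normD _ _) _; rewrite lerD.
  - exact: (bnd _ _ `|z|).
  rewrite RintegralD//; last 2 first.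
  - exact: (bnd _ _ `|v|).
  - exact: (bnd _ _ `|w|).
  rewrite !RintegralZl// Rintegral_cst//.
  by rewrite (congr1 fine (@probability_setT _ _ _ S)) mulr1.
have IF (S : probability T1 R) v w z :
    (I S (F v w z))%:E = (\int[S]_y (F v w z y)%:E)%E.
  by rewrite fineK//; apply: integrable_fin_num => //; exact: iF.
(* Domination on measurable sets passes to integrals of nonnegative functions, once [l] times [Q1]
   is read as a scaled measure; [uF] is the same with [u]. *)
have lF v w z : (forall y, 0 <= F v w z y) ->
    l * I Q1 (F v w z) <= I P1 (F v w z).
  move=> F0; rewrite -lee_fin EFinM !IF.
  rewrite -(ge0_integral_mscale Q1 measurableT (NngNum l0))//; last 2 first.
  - exact/measurable_EFinP.
  - by move=> y _; rewrite lee_fin.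
  apply: ge0_le_measure_integral => //.
  - by move=> B mB; have [] := PQ _ mB.
  - exact/measurable_EFinP.
have uF v w z : (forall y, 0 <= F v w z y) ->
    I P1 (F v w z) <= u * I Q1 (F v w z).
  move=> F0; rewrite -lee_fin EFinM !IF.
  rewrite -(ge0_integral_mscale Q1 measurableT (NngNum u0))//; last 2 first.
  - exact/measurable_EFinP.
  - by move=> y _; rewrite lee_fin.
  apply: ge0_le_measure_integral => //.
  - by move=> B mB; have [] := PQ _ mB.
  - exact/measurable_EFinP.
have PE : fine ((P1 \x P2)%E A) = I P1 h.
  congr fine; apply: eq_integral => y _ /=.
  by rewrite /h fine_probability.
have QE : fine ((Q1 \x Q2)%E A) = I Q1 g.
  congr fine; apply: eq_integral => y _ /=.
  by rewrite /g fine_probability.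
have F0 s y : 0 <= s -> 0 <= F (H (a * s) c) (- (a * s)) c y.
  move=> s0; have := PQ2 (a * s) c (mulr_ge0 a0 s0) c0 _ (mx y).
  by rewrite /F -/(h y) -/(g y); lra.
(* With [l = e^(t - eps)] and [u = e^t], integrate the two nonnegative functions
   [F0] against the nonnegative measures [P1 - l Q1] and [u Q1 - P1], which are
   the weights of [P1] and [Q1] at the likelihood ratios [u] and [l]. *)
rewrite PE QE.
have := lF _ _ _ (F0 u ^~ u0).
have := uF _ _ _ (F0 l ^~ l0).
rewrite !IE.
set ph := I P1 h; set pg := I P1 g; set qh := I Q1 h; set qg := I Q1 g.
set Du := H (a * u) c; set Dl := H (a * l) c.
have ul : 0 < u - l by rewrite subr_gt0 ltr_expR; lra.
(* Equivalently p * u + (1 - p) * l = 1: the two-point ratio has mean 1 under the second law. *)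
have pE : p * (u - l) = 1 - l.
  by have := onem_q_brE t eps0; rewrite q_brE -/u -/l -/p; lra.
move=> h1 h2.
(* After scaling by [u - l], the goal is the sum of [h1] and [h2]: the terms in [pg] and [qh]
   cancel. *)
rewrite -(ler_pM2l ul).
have -> : (u - l) * (p * Du + (1 - p) * Dl) =
  (p * (u - l)) * Du + ((u - l) - p * (u - l)) * Dl by ring.
rewrite pE.
have -> : (u - l) * (a * ph - c * qg) =
  a * u * ph - a * l * ph - c * u * qg + c * l * qg by ring.
lra.
Qed.

End likelihood_ratio.

(** * Upper bound for compositions and the binary mechanisms attaining it *)

Section composition.
Context {R : realType} {X : Type}.
Implicit Types (nb : X -> X -> Prop) (M N : mechanism R X).

(** Induction on [k], with [a] and [c] quantified inside since the product step uses the induction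
    hypothesis at other weights. *)
Lemma mech_comp_hockey_stick_le k (M : 'I_k -> mechanism R X) x x'
    (eps t : 'I_k -> R) :
  (forall i, 0 < eps i) -> (forall i, 0 <= t i <= eps i) ->
  (forall i A, measurable A ->
    ((expR (t i - eps i))%:E * M i x' A <= M i x A)%E /\
    (M i x A <= (expR (t i))%:E * M i x' A)%E) ->
  forall a c, 0 <= a -> 0 <= c -> forall A, measurable A ->
  a * fine (mech_comp M x A) - c * fine (mech_comp M x' A) <=
  hockey_stick (fun i => q_br (eps i) (t i)) (fun i => p_br (eps i) (t i)) a c.
Proof.
elim: k M eps t => [|k IH] M eps t e0 te MM a c a0 c0.
  (* On the one-point space both laws are the same Dirac mass, so [A] has mass 0 or 1 under both. *)
  rewrite /mech_comp big_ord0 => A _; rewrite hockey_stick0/= /dirac indicE.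
  case: (_ \in A); first by rewrite !mulr1 le_max lexx.
  by rewrite !mulr0 subrr le_max lexx orbT.
rewrite /mech_comp big_ord_recl hockey_stick_recl => A mA /=.
pose H := hockey_stick (fun i => q_br (eps (lift ord0 i)) (t (lift ord0 i)))
  (fun i => p_br (eps (lift ord0 i)) (t (lift ord0 i))).
apply: (@product_hockey_stick_le _ _ _ _ _ _ _ _ _ _ _ H).
- exact: e0.
- exact: te.
- by move=> B mB; apply: MM.
- by move=> s a1 c1 s0; apply: hockey_stickZ.
- by move=> a1 c1 a10 c10 B mB; apply: IH => // i; apply: MM.
- exact: a0.
- exact: c0.
- exact: mA.
Qed.

(** Singling out one point makes the pair of laws at [x0] and at any other point equal to
    (Bernoulli(q), Bernoulli(p)), on an arbitrary data universe. *)
Definition binary_mechanism (x0 : X) (q p : R) : mechanism R X :=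
  Mechanism (fun x => bernoulli_prob (if `[< x = x0 >] then q else p) :
    probability bool R).

Lemma binary_mechanism_bounded_range nb x0 eps t : 0 < eps -> 0 <= t <= eps ->
  bounded_range nb eps (binary_mechanism x0 (q_br eps t) (p_br eps t)).
Proof.
move=> e0 te; have q01 := q_br_itv e0 te; have p01 := p_br_itv e0 te.
set q := q_br eps t in q01 *; set p := p_br eps t in p01 *.
pose s x : R := if `[< x = x0 >] then q else p.
have s01 x : 0 <= s x <= 1 by rewrite /s; case: ifP.
(* The reference measure is the counting measure on [bool]. *)
exists (measure_add \d_true \d_false), (fun x b => if b then s x else 1 - s x).
split.
  split=> [x b|x|x A mA]; first by case/andP: (s01 x); case: b => //; lra.
  - by move=> ? ? ?.
  - rewrite ge0_integral_measure_add//; last first.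
      by move=> b _; rewrite lee_fin; case/andP: (s01 x); case: b => //; lra.
    rewrite !integral_dirac//= -/(s x) (bernoulli_probE (s01 x)).
    by congr (_ + _)%E; rewrite muleC.
move=> x x' _ y1 y2.
set e := expR eps; have e1 : 1 <= e by rewrite -expR0 ler_expR ltW.
have same (a b : R) : 0 <= a -> 0 <= b -> a * b <= e * (b * a).
  by move=> a0 b0; rewrite [b * a]mulrC ler_peMl// mulr_ge0.
have /andP[q0 q1] := q01; have /andP[p0 p1] := p01.
have oq : 0 <= 1 - q by rewrite subr_ge0.
have op : 0 <= 1 - p by rewrite subr_ge0.
(* The ratios e^t and e^(t - eps) differ by the factor e^eps, so the bounded-range inequality is an
   equality here; the other cases follow from [1 <= e]. *)
have qE : q * (1 - p) = e * ((1 - q) * p).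
  rewrite /q onem_q_brE// q_brE -/p expRD expRN -/e.
  have e0' : e != 0 by rewrite gt_eqF// (lt_le_trans _ e1).
  by field.
have pE : (1 - q) * p <= q * (1 - p) by rewrite qE ler_peMl// mulr_ge0.
have qp : p * (1 - q) <= e * ((1 - p) * q).
  rewrite [p * _]mulrC (le_trans pE)// [(1 - p) * q]mulrC.
  by rewrite ler_peMl// mulr_ge0.
have qp' : (1 - p) * q <= e * (p * (1 - q)).
  by rewrite mulrC qE [p * _]mulrC.
have pq : q * (1 - p) <= e * ((1 - q) * p) by rewrite qE.
have pq' : (1 - q) * p <= e * (q * (1 - p)).
  by rewrite mulrC [q * _]mulrC.
have same' (a b : R) : 0 <= a -> 0 <= b -> a * b <= e * (a * b).
  by move=> a0 b0; rewrite ler_peMl// mulr_ge0.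
by rewrite /s; case: y1 y2 => -[]; do 2 case: ifP => _ //;
  (exact: same || exact: same').
Qed.

(** The maximizing event is built recursively: each value of the first bit selects the event given
    by the induction hypothesis for the weights updated by that value. *)
Lemma mech_comp_hockey_stick_ge k (q p : 'I_k -> R) x0 x1 : x0 <> x1 ->
  (forall i, 0 <= q i <= 1) -> (forall i, 0 <= p i <= 1) ->
  forall a c, exists2 A,
    measurable A &
    hockey_stick q p a c <=
    a * fine (mech_comp (fun i => binary_mechanism x0 (q i) (p i)) x0 A) -
    c * fine (mech_comp (fun i => binary_mechanism x0 (q i) (p i)) x1 A).
Proof.
move=> x01; elim: k q p => [|k IH] q p q01 p01 a c.
  rewrite /mech_comp big_ord0 hockey_stick0/=.
  (* With no coordinates left, the whole space is chosen when [c <= a] and the empty set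
     otherwise. *)
  have [ac|ac] := leP 0 (a - c).
    by exists setT => //; rewrite /dirac indicE in_setT !mulr1.
  by exists set0 => //; rewrite /dirac indicE in_set0 !mulr0 subrr.
rewrite /mech_comp big_ord_recl hockey_stick_recl.
set N := \big[_/_]_(i < k) _.
have [A1 mA1 hA1] := IH _ _ (fun i => q01 (lift ord0 i))
  (fun i => p01 (lift ord0 i)) (a * q ord0) (c * p ord0).
have [A2 mA2 hA2] := IH _ _ (fun i => q01 (lift ord0 i))
  (fun i => p01 (lift ord0 i)) (a * (1 - q ord0)) (c * (1 - p ord0)).
pose A : set (bool * mech_out N) := [set y | if y.1 then A1 y.2 else A2 y.2].
have xA b : xsection A b = if b then A1 else A2.
  by apply/seteqP; split=> y; rewrite /xsection/= inE /A/=; case: b.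
have mA : measurable A.
  have -> : A = ([set true] `*` A1) `|` ([set false] `*` A2).
    apply/seteqP.
    split=> [[[] y]|[b y] [[/= -> //]|[/= -> //]]] /=; rewrite /A/=.
    by left.
    by right.
  by apply: measurableU; apply: measurableX.
have E x s : 0 <= s <= 1 -> fine ((bernoulli_prob s \x N x)%E A) =
    s * fine (N x A1) + (1 - s) * fine (N x A2).
  move=> s01; rewrite /product_measure1 integral_bernoulli_prob//= !xA.
  by rewrite -(fine_probability (N x) mA1) -(fine_probability (N x) mA2).
exists A => //=; rewrite asboolT// asboolF; last by move/esym.
by rewrite !E//; move: hA1 hA2; rewrite /mech_comp -/N; lra.
Qed.

End composition.

Theorem lemma3p1 (R : realType) (X : Type) (nb : X -> X -> Prop)
    (nb_sym : forall x x', nb x x' -> nb x' x)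
    (nb_ex : exists x x', x <> x' /\ nb x x')
    (k : nat) (k_ge1 : (1 <= k)%N)
    (eps : 'I_k -> R) (eps_gt0 : forall i, 0 < eps i) (eg : R) :
  delta_opt_class nb (BR_compositions nb eps) eg =
  ereal_sup
    [set (\sum_(S : {set 'I_k})
            Num.max
              ((\prod_(i | i \notin S) q_br (eps i) (t i)) *
                 (\prod_(i in S) (1 - q_br (eps i) (t i))) -
               expR eg *
                 ((\prod_(i | i \notin S) p_br (eps i) (t i)) *
                    (\prod_(i in S) (1 - p_br (eps i) (t i))))) 0)%:E
    | t in [set t : 'I_k -> R | forall i, 0 <= t i <= eps i]].
Proof.
pose T := [set t : 'I_k -> R | forall i, 0 <= t i <= eps i].
pose D (t : 'I_k -> R) := hockey_stick (fun i => q_br (eps i) (t i))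
  (fun i => p_br (eps i) (t i)) 1 (expR eg).
rewrite [X in ereal_sup X](_ : _ = [set (D t)%:E | t in T]); last first.
  congr [set _ | _ in _]; apply/funext => t; congr _%:E.
  by apply: eq_bigr => S _; rewrite mul1r.
have [x0 [x1 [x01 nb01]]] := nb_ex.
apply/eqP; rewrite eq_le; apply/andP; split; apply: ge_ereal_sup => d.
- case=> _ [M brM ->] <-; set s := ereal_sup _.
  have Ds t : T t -> ((D t)%:E <= s)%E.
    by move=> Tt; apply: ereal_sup_ubound; exists t.
  (* The parameter box is nonempty, which rules out the value -oo for [s]. *)
  have T0 : T (fun=> 0) by move=> i; rewrite lexx ltW.
  case E : s => [r| |]; last by have := Ds _ T0; rewrite E.
    (* A finite supremum is itself an admissible delta: the parameters [t] depend on the pair [x],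
       [x'], but [r] bounds [D t] for all of them. *)
    apply: ereal_inf_lbound; exists r => // x x' xx' A mA.
    have /choice[t tP] := fun i => bounded_range_likelihood_ratio (brM i) xx'.
    have Tt : T t by move=> i; have [] := tP i.
    have := Ds _ Tt; rewrite E lee_fin => Dr.
    rewrite -(fine_probability (mech_comp M x) mA).
    rewrite -(fine_probability (mech_comp M x') mA) -EFinM -EFinD lee_fin.
    have := mech_comp_hockey_stick_le eps_gt0 Tt (fun i => (tP i).2) ler01
      (expR_ge0 eg) mA.
    rewrite mul1r lerBlDl => /le_trans; apply.
    by rewrite lerD2l.
  exact: leey.
- case=> t Tt <-.
  pose q i := q_br (eps i) (t i); pose p i := p_br (eps i) (t i).
  pose M := mech_comp (fun i => binary_mechanism x0 (q i) (p i)).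
  apply: (@le_trans _ _ (delta_opt nb M eg)); last first.
    apply: ereal_sup_ubound; exists M => //.
    exists (fun i => binary_mechanism x0 (q i) (p i)) => // i.
    exact: binary_mechanism_bounded_range.
  (* Any admissible delta is at least the gap that the event [A] exhibits on the pair [x0], [x1]. *)
  apply: le_ereal_inf_tmp => _ [delta /= dpM <-].
  have [A mA DA] := mech_comp_hockey_stick_ge x01
    (fun i => q_br_itv (eps_gt0 i) (Tt i))
    (fun i => p_br_itv (eps_gt0 i) (Tt i))
    1 (expR eg).
  rewrite lee_fin (le_trans DA)//.
  have := dpM _ _ nb01 _ mA.
  rewrite -(fine_probability (M x0) mA) -(fine_probability (M x1) mA).
  by rewrite -EFinM -EFinD lee_fin mul1r lerBlDl.
Qed.
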